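(* A circular net $f:\mathbb Z^m\to\mathbb R^N$ with $m\ge3$ (in general position) is discrete isothermic if and only if for every $u\in\mathbb Z^m$ and every triple of distinct indices $i,j,k$, $$q(f,f_i,f_{ij},f_j)\cdot q(f,f_j,f_{jk},f_k)\cdot q(f,f_k,f_{ki},f_i)=1.$$
   Context: Notation: for $f:\mathbb Z^m\to\mathbb R^N$, $f=f(u)$, $f_i=f(u+e_i)$, $f_{ij}=f_{ji}=f(u+e_i+e_j)$ with $e_i$ the unit vectors. A Q-net is a map such that each elementary quadrilateral $(f,f_i,f_{ij},f_j)$ ($i\ne j$) is planar, assumed non-degenerate (distinct vertices, no three collinear, diagonals meeting in a point distinct from the vertices). Two planar quadrilaterals $(A,B,C,D)$, $(A^*,B^*,C^*,D^* )$ are dual if $A^*B^*\parallel AB$, $B^*C^*\parallel BC$, $C^*D^*\parallel CD$, $D^*A^*\parallel DA$, $A^*C^*\parallel BD$, $B^*D^*\parallel AC$. A Q-net $f$ is a discrete Koenigs net if there is a Q-net $f^*$ with every $(f^*,f^*_i,f^*_{ij},f^*_j)$ dual to $(f,f_i,f_{ij},f_j)$. A circular net is a Q-net all of whose elementary quadrilaterals have their four vertices on a circle. A discrete isothermic net is a circular net which is a discrete Koenigs net. For four concircular points $a,b,c,d\in\mathbb R^N$, their cross-ratio is $q(a,b,c,d)=(a-b)(b-c)^{-1}(c-d)(d-a)^{-1}$, computed after identifying a $2$-plane containing them with $\mathbb C$ (complex multiplication); it is real and independent of the identification. *)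

(* Defs.v *)
From HB Require Import structures.
From mathcomp Require Import all_boot all_order all_algebra.
From Stdlib Require Import ClassicalEpsilon.
Set Implicit Arguments. Unset Strict Implicit. Unset Printing Implicit Defensive.
Import Order.TTheory GRing.Theory Num.Theory.
Local Open Scope ring_scope.

Section Defs.
Variables (R : rcfType) (m N : nat).
Notation pt := 'rV[R]_N.

Definition e (i : 'I_m) : 'rV[int]_m := delta_mx 0 i.
Definition sh (u : 'rV[int]_m) (i : 'I_m) : 'rV[int]_m := u + e i.

Definition dot (v w : pt) : R := \sum_(k < N) v 0 k * w 0 k.

Definition parallel (v w : pt) : bool := (\rank (col_mx v w) <= 1)%N.
Definition collinear (A B C : pt) : bool := (\rank (col_mx (B - A) (C - A)) <= 1)%N.
Definition coplanar (A B C D : pt) : bool :=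
  (\rank (col_mx (B - A) (col_mx (C - A) (D - A))) <= 2)%N.

Definition nondeg_quad (A B C D : pt) : Prop :=
  [/\ uniq [:: A; B; C; D],
      [&& ~~ collinear A B C, ~~ collinear B C D, ~~ collinear C D A & ~~ collinear D A B]
    & exists (P : pt) (s t : R),
        [/\ P = A + s *: (C - A), P = B + t *: (D - B) & P \notin [:: A; B; C; D]]].

Definition planar_quad (A B C D : pt) : Prop := coplanar A B C D /\ nondeg_quad A B C D.

Definition Qnet (f : 'rV[int]_m -> pt) : Prop :=
  forall u i j, i != j ->
    planar_quad (f u) (f (sh u i)) (f (sh (sh u i) j)) (f (sh u j)).

Definition dual_quads (A B C D A' B' C' D' : pt) : Prop :=
  [/\ parallel (B' - A') (B - A), parallel (C' - B') (C - B),
      parallel (D' - C') (D - C) & parallel (A' - D') (A - D)] /\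
  (parallel (C' - A') (D - B) /\ parallel (D' - B') (C - A)).

Definition Koenigs_net (f : 'rV[int]_m -> pt) : Prop :=
  Qnet f /\ exists fs : 'rV[int]_m -> pt, Qnet fs /\
    forall u i j, i != j ->
      dual_quads (f u) (f (sh u i)) (f (sh (sh u i) j)) (f (sh u j))
                 (fs u) (fs (sh u i)) (fs (sh (sh u i) j)) (fs (sh u j)).

Definition concircular (A B C D : pt) : Prop :=
  exists c : pt,
    (\rank (col_mx (B - A) (col_mx (C - A) (col_mx (D - A) (c - A)))) <= 2)%N /\
    dot (B - c) (B - c) = dot (A - c) (A - c) /\
    dot (C - c) (C - c) = dot (A - c) (A - c) /\
    dot (D - c) (D - c) = dot (A - c) (A - c).

Definition circular_net (f : 'rV[int]_m -> pt) : Prop :=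
  Qnet f /\ forall u i j, i != j ->
    concircular (f u) (f (sh u i)) (f (sh (sh u i) j)) (f (sh u j)).

Definition discrete_isothermic (f : 'rV[int]_m -> pt) : Prop :=
  circular_net f /\ Koenigs_net f.

(** general position (our reading): every elementary 3D cube is
    non-planar, i.e. f, f_i, f_j, f_k are affinely independent *)
Definition general_position (f : 'rV[int]_m -> pt) : Prop :=
  forall u i j k, i != j -> j != k -> k != i ->
    \rank (col_mx (f (sh u i) - f u) (col_mx (f (sh u j) - f u) (f (sh u k) - f u))) = 3%N.

Definition cmul (z w : R * R) : R * R := (z.1 * w.1 - z.2 * w.2, z.1 * w.2 + z.2 * w.1).
Definition csub (z w : R * R) : R * R := (z.1 - w.1, z.2 - w.2).
Definition cinv (z : R * R) : R * R :=
  (z.1 / (z.1 ^+ 2 + z.2 ^+ 2), - z.2 / (z.1 ^+ 2 + z.2 ^+ 2)).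

(** an identification of an affine 2-plane containing the given points with C:
    origin p, orthonormal basis (e1,e2), all points lie in p + span(e1,e2) *)
Definition plane_frame (pts : seq pt) (F : pt * pt * pt) : Prop :=
  let: (p, e1, e2) := F in
  [/\ dot e1 e1 = 1, dot e2 e2 = 1, dot e1 e2 = 0 &
      forall x, x \in pts -> x = p + dot (x - p) e1 *: e1 + dot (x - p) e2 *: e2].

Definition ccoord (F : pt * pt * pt) (x : pt) : R * R :=
  let: (p, e1, e2) := F in (dot (x - p) e1, dot (x - p) e2).

(** cross-ratio q(a,b,c,d) = (a-b)(b-c)^{-1}(c-d)(d-a)^{-1}, computed in some
    (chosen) identification of a 2-plane containing a,b,c,d with C; it is
    real (for concircular points), so we return its real part. *)
Definition cross_ratio (a b c d : pt) : R :=
  let F := epsilon (inhabits (0, 0, 0)) (plane_frame [:: a; b; c; d]) in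
  let z := ccoord F in
  (cmul (cmul (csub (z a) (z b)) (cinv (csub (z b) (z c))))
        (cmul (csub (z c) (z d)) (cinv (csub (z d) (z a))))).1.

End Defs.

(* Main.v *)
Require Import Defs.
From HB Require Import structures.
From mathcomp Require Import all_boot all_order all_algebra.
From mathcomp Require Import ring.
From Stdlib Require Import ClassicalEpsilon.
Import Order.TTheory GRing.Theory Num.Theory.
Local Open Scope ring_scope.
Set Implicit Arguments.
Unset Strict Implicit.
Unset Printing Implicit Defensive.

(** Write [b = B - A], [d = D - A] and [C - A = x b + y d] for a planar quadrilateral
    [A B C D].  When it is circular its cross-ratio is [- x |b|^2 / (y |d|^2)], and
    when [A' B' C' D'] is dual to it, the factors by which [b] and [d] are scaled
    are in the ratio [- x / y].  Multiplied by the squared edge lengths, the edge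
    factors of a dual net thus become labels [l i] whose ratios [l i / l j] are the
    cross-ratios, and the product over a triple of indices telescopes to 1.

    Conversely, at a vertex [u] the product condition says that
    [f, f_ij, f_jk, f_ki] are coplanar; by Moebius' theorem so are
    [f_i, f_j, f_k, f_ijk], and this forces opposite faces of the cube to have equal
    cross-ratios.  Hence the cross-ratios factor as [l i / l j] with [l i] depending
    on the i-th coordinate only, and the edge vectors
    [l i / |f_i - f|^2 * (f_i - f)] form a closed 1-form on the lattice whose
    primitive is the dual net. *)

(** * Equations from linear combinations of known equations *)

Lemma eq_of_sub (V : zmodType) (a b c d : V) : c = d -> a - b = c - d -> a = b.
Proof. by move=> ->; rewrite subrr => /eqP; rewrite subr_eq0 => /eqP. Qed.

(** Here and in the next two lemmas the [k]s form a certificate: once they are supplied, only an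
    identity for [ring] or [field] remains. *)
Lemma eq_of_lin1 (T : pzRingType) (k a1 b1 a b : T) :
  a1 = b1 -> a - b = k * (a1 - b1) -> a = b.
Proof. by move=> ->; rewrite subrr mulr0 => /eqP; rewrite subr_eq0 => /eqP. Qed.

Lemma eq_of_lin2 (T : pzRingType) (k1 k2 a1 b1 a2 b2 a b : T) :
  a1 = b1 -> a2 = b2 -> a - b = k1 * (a1 - b1) + k2 * (a2 - b2) -> a = b.
Proof. by move=> -> ->; rewrite !subrr !mulr0 addr0 => /eqP; rewrite subr_eq0 => /eqP. Qed.

Lemma eq_of_lin3 (T : pzRingType) (k1 k2 k3 a1 b1 a2 b2 a3 b3 a b : T) :
  a1 = b1 -> a2 = b2 -> a3 = b3 ->
  a - b = k1 * (a1 - b1) + k2 * (a2 - b2) + k3 * (a3 - b3) -> a = b.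
Proof. by move=> -> -> ->; rewrite !subrr !mulr0 !addr0 => /eqP; rewrite subr_eq0 => /eqP. Qed.

(** * Matrix rank and linear dependence of two or three vectors *)

Section LinearDependence.
Variables (F : fieldType) (N : nat).
Implicit Types v w z : 'rV[F]_N.

Definition free2 v w : Prop :=
  forall s t : F, s *: v + t *: w = 0 -> s = 0 /\ t = 0.

Definition free3 v w z : Prop :=
  forall s t r : F, s *: v + t *: w + r *: z = 0 -> [/\ s = 0, t = 0 & r = 0].

Lemma mul_row_col2 s t v w :
  row_mx s%:M t%:M *m col_mx v w = s *: v + t *: w.
Proof. by rewrite mul_row_col !mul_scalar_mx. Qed.

Lemma row2P (u : 'rV[F]_(1 + 1)) : exists s t, u = row_mx s%:M t%:M.
Proof.
exists (lsubmx u 0 0), (rsubmx u 0 0).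
by rewrite -!mx11_scalar hsubmxK.
Qed.

Lemma scalar_mx11_eq0 s : (s%:M == 0 :> 'M[F]_1) = (s == 0).
Proof.
apply/eqP/eqP => [/(congr1 (fun M : 'M_1 => M 0 0))|->]; last exact: raddf0.
by rewrite !mxE eqxx.
Qed.

Lemma row2_eq0 s t : (row_mx s%:M t%:M == 0 :> 'rV[F]_(1 + 1)) = (s == 0) && (t == 0).
Proof. by rewrite row_mx_eq0 !scalar_mx11_eq0. Qed.

Lemma free2P v w : reflect (free2 v w) (~~ (\rank (col_mx v w) <= 1)%N).
Proof.
have -> : ~~ (\rank (col_mx v w) <= 1)%N = row_free (col_mx v w).
  by rewrite -ltnNge /row_free eqn_leq rank_leq_row.
apply: (iffP idP) => [fr s t e|fr].
  move: e; rewrite -mul_row_col2 => /eqP; rewrite mulmx_free_eq0 //.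
  by rewrite row2_eq0 => /andP[/eqP-> /eqP->].
apply: inj_row_free => u; have [s [t ->]] := row2P u.
by rewrite mul_row_col2 => /fr[-> ->]; apply/eqP; rewrite row2_eq0 eqxx.
Qed.

Lemma dep2P v w : (\rank (col_mx v w) <= 1)%N ->
  exists s t, (s != 0) || (t != 0) /\ s *: v + t *: w = 0.
Proof.
move=> le1; have : ~~ row_free (col_mx v w).
  by rewrite /row_free neq_ltn ltnS le1.
rewrite -kermx_eq0 => /rowV0Pn[u /sub_kermxP ueq0].
have [s [t def_u]] := row2P u; rewrite def_u row2_eq0 negb_and => nz.
by exists s, t; rewrite -mul_row_col2 -def_u.
Qed.

Lemma parallelP v w : w != 0 -> (\rank (col_mx v w) <= 1)%N -> exists k, v = k *: w.
Proof.
move=> wn0 /dep2P[s [t [nz e]]].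
have sn0 : s != 0.
  apply: contraNneq wn0 => s0; move: nz e; rewrite s0 eqxx scale0r add0r /= => tn0.
  by move/eqP; rewrite scaler_eq0 (negPf tn0).
exists (- t / s); apply: (scalerI sn0); rewrite scalerA mulrCA divff // mulr1 scaleNr.
by apply/eqP; rewrite -addr_eq0 e.
Qed.

Lemma parallel_scale k w : (\rank (col_mx (k *: w) w) <= 1)%N.
Proof.
apply: contraTT (isT) => /free2P/(_ 1 (- k)).
by rewrite scale1r scaleNr subrr => /(_ erefl)[/eqP]; rewrite oner_eq0.
Qed.

(** A nontrivial relation among the three rows must involve [z], since [v] and [w] are free. The row
    [z] stands in the middle because [coplanar A B C D] lists the diagonal [C - A] between the sides
    [B - A] and [D - A]. *)
Lemma in_span2 v w z : free2 v w -> (\rank (col_mx v (col_mx z w)) <= 2)%N ->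
  exists x y, z = x *: v + y *: w.
Proof.
move=> fr le2; have : ~~ row_free (col_mx v (col_mx z w)).
  by rewrite /row_free neq_ltn ltnS le2.
rewrite -kermx_eq0 => /rowV0Pn[u /sub_kermxP].
rewrite -[u]hsubmxK [lsubmx u]mx11_scalar; move: (lsubmx u 0 0) => s.
have [t [r ->]] := row2P (rsubmx u).
rewrite mul_row_col mul_row_col2 mul_scalar_mx => e nz.
have tn0 : t != 0.
  apply: contraNneq nz => t0; move: e; rewrite t0 scale0r add0r => /fr[-> ->].
  by rewrite row_mx_eq0 row2_eq0 !scalar_mx11_eq0 eqxx.
exists (- s / t), (- r / t); apply: (scalerI tn0).
rewrite scalerDr !scalerA ![t * _]mulrCA divff // !mulr1 !scaleNr -opprD.
by apply/eqP; rewrite -addr_eq0 addrCA e.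
Qed.

Lemma in_span2_rank v w x y : (\rank (col_mx v (col_mx (x *: v + y *: w) w)) <= 2)%N.
Proof.
apply: (leq_trans (n := \rank (col_mx v w))); last exact: rank_leq_row.
apply: mxrankS; rewrite !col_mx_sub.
have sv : (v <= col_mx v w)%MS by rewrite -addsmxE addsmxSl.
have sw : (w <= col_mx v w)%MS by rewrite -addsmxE addsmxSr.
by rewrite sv sw addmx_sub // scalemx_sub.
Qed.

Lemma rank3_free3 v w z : \rank (col_mx v (col_mx w z)) = 3%N -> free3 v w z.
Proof.
move=> rk s t r e.
have fr : row_free (col_mx v (col_mx w z)) by rewrite /row_free rk.
have : row_mx s%:M (row_mx t%:M r%:M) *m col_mx v (col_mx w z) == 0.
  by rewrite mul_row_col mul_row_col2 mul_scalar_mx addrA e.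
rewrite mulmx_free_eq0 // row_mx_eq0 row2_eq0 scalar_mx11_eq0.
by case/and3P => /eqP-> /eqP-> /eqP->.
Qed.

End LinearDependence.

(** * Inner product and affine coordinates of planar quadrilaterals *)

Section Quadrilaterals.
Variables (R : rcfType) (N : nat).
Notation pt := 'rV[R]_N.
Implicit Types (A B C D v w : pt) (x y : R).

Lemma dotC v w : dot v w = dot w v.
Proof. by apply: eq_bigr => k _; rewrite mulrC. Qed.

Lemma dotDl v1 v2 w : dot (v1 + v2) w = dot v1 w + dot v2 w.
Proof. by rewrite -big_split; apply: eq_bigr => k _; rewrite mxE mulrDl. Qed.

Lemma dotZl (a : R) v w : dot (a *: v) w = a * dot v w.
Proof. by rewrite mulr_sumr; apply: eq_bigr => k _; rewrite mxE mulrA. Qed.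

Lemma dotDr v w1 w2 : dot v (w1 + w2) = dot v w1 + dot v w2.
Proof. by rewrite dotC dotDl !(dotC v). Qed.

Lemma dotZr (a : R) v w : dot v (a *: w) = a * dot v w.
Proof. by rewrite dotC dotZl (dotC v). Qed.

Lemma dotNl v w : dot (- v) w = - dot v w.
Proof. by rewrite -scaleN1r dotZl mulN1r. Qed.

Lemma dotNr v w : dot v (- w) = - dot v w.
Proof. by rewrite dotC dotNl dotC. Qed.

Definition dotE := (dotDl, dotDr, dotZl, dotZr, dotNl, dotNr).

Lemma dot_ge0 v : 0 <= dot v v.
Proof. by apply: sumr_ge0 => k _; rewrite -expr2 sqr_ge0. Qed.

Lemma dot_eq0 v : (dot v v == 0) = (v == 0).
Proof.
apply/idP/eqP => [|->]; last by rewrite /dot big1 // => k _; rewrite mxE mul0r.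
rewrite psumr_eq0 => [/allP v0|k _]; last by rewrite -expr2 sqr_ge0.
apply/rowP => k; rewrite mxE; apply/eqP.
by have := v0 k (mem_index_enum _); rewrite mulf_eq0 orbb.
Qed.

Lemma free2_neq0 v w : free2 v w -> (v != 0) * (w != 0).
Proof.
move=> fr; split; apply/eqP => z0.
  by have [] := fr 1 0; rewrite ?z0 ?scaler0 ?scale0r ?addr0 // => /eqP; rewrite oner_eq0.
by have [] := fr 0 1; rewrite ?z0 ?scaler0 ?scale0r ?addr0 // => _ /eqP; rewrite oner_eq0.
Qed.

(** Nondegeneracy in the affine frame at [A]: [x = 0], [y = 0] and [x + y = 1] would put [C] on the
    lines [AD], [AB] and [BD], while [x + y = 0] would make the diagonals parallel. *)
Definition quad_coord A B C D x y : Prop :=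
  [/\ C - A = x *: (B - A) + y *: (D - A), free2 (B - A) (D - A),
      x != 0, y != 0 & (x + y != 0) && (x + y != 1)].

Lemma quad_coord_swap A B C D x y : quad_coord A B C D x y -> quad_coord A D C B y x.
Proof.
case=> e fr xn0 yn0 xy; split; rewrite ?(addrC y) //; first by rewrite e addrC.
by move=> s t; rewrite addrC => /fr[].
Qed.

Lemma planar_quad_coord A B C D : planar_quad A B C D ->
  exists x y, quad_coord A B C D x y.
Proof.
case=> cop [_ /and4P[nABC nBCD nCDA nDAB] [P [s [t [PA PB]]]]].
rewrite !inE !negb_or => /and4P[nPA nPB nPC nPD].
have fr : free2 (B - A) (D - A).
  move=> a b ab0; move/free2P: nDAB => /(_ (- (a + b)) a).
  case=> [|/eqP + a0]; last by rewrite a0 oppr_eq0 add0r => /eqP.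
  by rewrite -ab0; apply/rowP => k; rewrite !mxE; ring.
have [x [y e]] := in_span2 fr cop.
have defC : C = A + x *: (B - A) + y *: (D - A) by rewrite -addrA -e addrC subrK.
exists x, y; split => //.
- apply: contraNneq nCDA => x0; apply/negbNE/negP => /free2P/(_ y (-(y-1))).
  have {}defC : C = A + y *: (D - A) by rewrite defC x0 scale0r addr0.
  case; first by rewrite defC; apply/rowP => k; rewrite !mxE; ring.
  by move=> -> /eqP; rewrite oppr_eq0 sub0r oppr_eq0 oner_eq0.
- apply: contraNneq nABC => y0; apply/negbNE/negP => /free2P/(_ (-x) 1).
  have {}defC : C = A + x *: (B - A) by rewrite defC y0 scale0r addr0.
  case; first by rewrite defC; apply/rowP => k; rewrite !mxE; ring.
  by move=> _ /eqP; rewrite oner_eq0.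
(* Equating the two expressions of the diagonal point [P] gives [1 - t = s * x] and [t = s * y],
   hence [s * (x + y) = 1]. If [x + y = 1], then [s = 1] and [P] would be [C]. *)
have := PA; rewrite PB defC => e2.
have [] := fr (1 - t - s * x) (t - s * y).
  apply/rowP => k; have := congr1 (fun v : pt => v 0 k) e2; rewrite !mxE => e2k.
  by apply: (eq_of_sub e2k); ring.
move=> /eqP; rewrite subr_eq0 => /eqP t1 /eqP; rewrite subr_eq0 => /eqP t2.
have sxy : s * (x + y) = 1 by rewrite mulrDr -t1 -t2 subrK.
apply/andP; split; apply: contra_eq_neq sxy => xy0.
  by rewrite xy0 mulr0 eq_sym oner_eq0.
apply: contraNneq nPC; rewrite xy0 mulr1 => s1.
by rewrite PA s1 scale1r addrC subrK.
Qed.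

Lemma coord_planar_quad A B C D x y : quad_coord A B C D x y -> planar_quad A B C D.
Proof.
case=> e fr xn0 yn0 /andP[xyn0 xyn1].
have defC : C = A + x *: (B - A) + y *: (D - A) by rewrite -addrA -e addrC subrK.
have indep s t : (s != 0) || (t != 0) -> s *: (B - A) + t *: (D - A) != 0.
  by apply: contraTneq => /fr[-> ->]; rewrite eqxx.
have neq X Y s t : (s != 0) || (t != 0) -> Y - X = s *: (B - A) + t *: (D - A) -> X != Y.
  by move=> st eXY; rewrite eq_sym -subr_eq0 eXY indep.
have w0 : x + y - 1 != 0 by rewrite subr_eq0.
(* The line [BD] is where the two coordinates sum to 1, which fixes the parameter along [AC]. *)
pose P := A + (x + y)^-1 *: (C - A).
split; first by rewrite /coplanar e; exact: in_span2_rank.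
split.
- rewrite /= !inE !negb_or !andbT -!andbA; do ?[apply/andP; split].
  + apply: (@neq _ _ 1 0); rewrite ?oner_neq0 //.
    by apply/rowP => k; rewrite !mxE; ring.
  + by apply: (@neq _ _ x y); rewrite ?xn0.
  + apply: (@neq _ _ 0 1); rewrite ?oner_neq0 ?orbT //.
    by apply/rowP => k; rewrite !mxE; ring.
  + apply: (@neq _ _ (x-1) y); rewrite ?yn0 ?orbT //.
    by rewrite defC; apply/rowP => k; rewrite !mxE; ring.
  + apply: (@neq _ _ (-1) 1); rewrite ?oner_neq0 ?orbT //.
    by apply/rowP => k; rewrite !mxE; ring.
  + apply: (@neq _ _ (-x) (1-y)); rewrite ?oppr_eq0 ?xn0 //.
    by rewrite defC; apply/rowP => k; rewrite !mxE; ring.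
(* Each dependence is expanded in the frame [B - A], [D - A]; freeness turns it into two scalar
   equations. *)
- apply/and4P; split; apply/free2P => s t.
  + move=> st0; have [] := fr (s + t * x) (t * y).
      by rewrite -st0 defC; apply/rowP => k; rewrite !mxE; ring.
    by move=> + /eqP; rewrite mulf_eq0 (negPf yn0) orbF => + /eqP t0; rewrite t0 mul0r addr0.
  + move=> st0; have [] := fr (s * (x - 1) - t) (s * y + t).
      by rewrite -st0 defC; apply/rowP => k; rewrite !mxE; ring.
    move=> e1 e2; have /eqP : s * (x + y - 1) = 0.
      by apply: (eq_of_sub (f_equal2 +%R e1 e2)); ring.
    rewrite mulf_eq0 (negPf w0) orbF => /eqP s0.
    by move: e2; rewrite s0 mul0r add0r.
  + move=> st0; have [] := fr (- (s * x) - t * x) (s * (1 - y) - t * y).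
      by rewrite -st0 defC; apply/rowP => k; rewrite !mxE; ring.
    move/eqP; rewrite -opprD -mulrDl oppr_eq0 mulf_eq0 (negPf xn0) orbF => /eqP sst.
    have -> : s * (1 - y) - t * y = s - (s + t) * y by ring.
    by rewrite sst mul0r subr0 => s0; move: sst; rewrite s0 add0r.
  + move=> st0; have [] := fr t (- s - t).
      by rewrite -st0; apply/rowP => k; rewrite !mxE; ring.
    by move=> ->; rewrite subr0 => /eqP; rewrite oppr_eq0 => /eqP.
exists P, (x + y)^-1, (y / (x + y)); split => //.
  by rewrite /P defC; apply/rowP => k; rewrite !mxE; field.
rewrite !inE !negb_or; apply/and4P; split; rewrite eq_sym.
- apply: (@neq _ _ (x / (x + y)) (y / (x + y))); first by rewrite mulf_neq0 ?invr_eq0.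
  by rewrite /P defC; apply/rowP => k; rewrite !mxE; field.
- apply: (@neq _ _ (- y / (x + y)) (y / (x + y))).
    by rewrite orbC mulf_neq0 ?invr_eq0.
  by rewrite /P defC; apply/rowP => k; rewrite !mxE; field.
- apply: (@neq _ _ (- (x * (x + y - 1)) / (x + y)) (- (y * (x + y - 1)) / (x + y))).
    by rewrite !(mulf_eq0, invr_eq0, oppr_eq0) !negb_or xn0 w0 xyn0.
  by rewrite /P defC; apply/rowP => k; rewrite !mxE; field.
- apply: (@neq _ _ (x / (x + y)) (- x / (x + y))); first by rewrite mulf_neq0 ?invr_eq0.
  by rewrite /P defC; apply/rowP => k; rewrite !mxE; field.
Qed.

End Quadrilaterals.

(** * Circular quadrilaterals and their cross-ratios *)

Section Circles.
Variables (R : rcfType) (N : nat).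
Notation pt := 'rV[R]_N.
Implicit Types (A B C D v w : pt) (x y : R).

Local Notation sqn v := (dot v v).

(** Relative to [A], each circle equation is affine in the centre; the combination of those at [C],
    [B], [D] with weights [1], [- x], [- y] eliminates the centre. *)
Lemma concircular_coord A B C D x y :
  concircular A B C D -> quad_coord A B C D x y ->
  x * (x - 1) * sqn (B - A) + y * (y - 1) * sqn (D - A)
    + 2%:R * x * y * dot (B - A) (D - A) = 0.
Proof.
case=> c [_ [eB [eC eD]]] [eCA _ _ _ _].
have shift X : X - c = (X - A) + (A - c) by rewrite addrA subrK.
move: eB eC eD; rewrite (shift B) (shift C) (shift D) eCA.
move: (B - A) (D - A) (A - c) => b d g; rewrite !dotE.
rewrite (dotC g b) (dotC g d) (dotC d b) => eB eC eD.
by apply: (eq_of_lin3 (k1 := - x) (k2 := 1) (k3 := - y) eB eC eD); ring.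
Qed.

(** Adding a multiple of the circle equation removes both [dot (B - A) (D - A)] and the square of
    [B - A] from the expansion. Applied to the reversed quadrilateral, this relates [CD] to [AB]. *)
Lemma concircular_sqnBC A B C D x y :
  concircular A B C D -> quad_coord A B C D x y ->
  x * sqn (C - B) = y * (x + y - 1) * sqn (D - A).
Proof.
move=> circ qc; have := concircular_coord circ qc; case: qc => eCA _ _ _ _.
have -> : C - B = (C - A) - (B - A) by rewrite opprB addrA subrK.
rewrite eCA; move: (B - A) (D - A) => b d E; rewrite !dotE (dotC d b).
by apply: (eq_of_lin1 (k := x - 1) E); ring.
Qed.

(** Gram-Schmidt on the sides at [A]. Existence of a frame is what makes the one chosen by [epsilon]
    in [cross_ratio] satisfy its specification. *)
Lemma plane_frame_exists A B C D x y :
  quad_coord A B C D x y -> exists F, plane_frame [:: A; B; C; D] F.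
Proof.
case=> eCA fr _ _ _; have [bn0 dn0] := free2_neq0 fr.
have defC : C = A + x *: (B - A) + y *: (D - A) by rewrite -addrA -eCA addrC subrK.
have defB : B = A + (B - A) by rewrite addrC subrK.
have defD : D = A + (D - A) by rewrite addrC subrK.
move: fr bn0 dn0 defC defB defD; move: (B - A) (D - A) => b d fr bn0 dn0 -> -> ->.
have normalize v : v != 0 -> exists2 r, r != 0 & r * r * sqn v = 1.
  move=> vn0; have sv : 0 < sqn v by rewrite lt_def dot_ge0 dot_eq0 vn0.
  have sq : Num.sqrt (sqn v) * Num.sqrt (sqn v) = sqn v by rewrite -expr2 sqr_sqrtr ?ltW.
  exists (Num.sqrt (sqn v))^-1; first by rewrite invr_eq0 sqrtr_eq0 -ltNge.
  by rewrite -invfM sq mulVf ?gt_eqF.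
have [r rn0 r1] := normalize b bn0.
pose h := d - (dot b d / sqn b) *: b.
have bb0 : sqn b != 0 by rewrite dot_eq0.
have hn0 : h != 0.
  apply/eqP => h0; have [] := fr (- (dot b d / sqn b)) 1.
    by rewrite scale1r scaleNr addrC.
  by move=> _ /eqP; rewrite oner_eq0.
have [s sn0 s1] := normalize h hn0.
have bh0 : dot b h = 0 by rewrite !dotE divfK // subrr.
have defd : d = h + (dot b d / sqn b) *: b by rewrite subrK.
clearbody h.
have b1 : dot b (r *: b) *: (r *: b) = b.
  by rewrite dotZr scalerA mulrAC r1 scale1r.
have b2 : dot b (s *: h) = 0 by rewrite dotZr bh0 mulr0.
have h1 : dot h (r *: b) = 0 by rewrite dotZr dotC bh0 mulr0.
have h2 : dot h (s *: h) *: (s *: h) = h.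
  by rewrite dotZr scalerA mulrAC s1 scale1r.
(* Orthonormal expansion for all points with coordinates in [b] and [h]; the four vertices are
   instances. *)
have frame p q : let X := A + p *: b + q *: h in
    X = A + dot (X - A) (r *: b) *: (r *: b) + dot (X - A) (s *: h) *: (s *: h).
  move=> X; have -> : X - A = p *: b + q *: h by rewrite /X; apply/rowP => i; rewrite !mxE; ring.
  rewrite !(dotDl, dotZl _ _ (r *: b), dotZl _ _ (s *: h)) h1 b2 !mulr0 addr0 add0r.
  by rewrite -[(p * _) *: _]scalerA -[(q * _) *: _]scalerA b1 h2.
exists (A, r *: b, s *: h); split.
- by rewrite !dotE mulrA.
- by rewrite dotZl dotZr mulrA.
- by rewrite dotZl b2 mulr0.
move=> X; rewrite !inE; set k := dot b d / sqn b in defd.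
case/or4P => /eqP->.
- by have /= := frame 0 0; rewrite !scale0r !addr0.
- by have /= := frame 1 0; rewrite scale1r scale0r addr0.
- have /= := frame (x + y * k) y.
  suff -> : A + (x + y * k) *: b + y *: h = A + x *: b + y *: d by [].
  by rewrite {1}defd; apply/rowP => i; rewrite !mxE; ring.
- have /= := frame k 1.
  suff -> : A + k *: b + 1 *: h = A + d by [].
  by rewrite {1}defd; apply/rowP => i; rewrite !mxE; ring.
Qed.

(* With [b = B - A] and [d = D - A] read in C, reality of the cross-ratio
   amounts to [y d^* (C - D) = - x b^* (C - B)], which is the circle equation. *)
Lemma cross_ratioE A B C D x y :
  concircular A B C D -> quad_coord A B C D x y ->
  cross_ratio A B C D * (y * sqn (D - A)) = - (x * sqn (B - A)).
Proof.
move=> circ qc; have E := concircular_coord circ qc.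
have E1 := concircular_sqnBC circ qc.
have := epsilon_spec (inhabits (0, 0, 0)) _ (plane_frame_exists qc).
rewrite /cross_ratio; case: (epsilon _ _) => [[p e1] e2] [n1 n2 n12 inF].
case: qc => eCA fr xn0 yn0 /andP[_ xyn1]; have [bn0 dn0] := free2_neq0 fr.
have zE X Y k : dot (X - p) k - dot (Y - p) k = dot (X - Y) k.
  by rewrite -dotNl -dotDl opprB addrA subrK.
(* The origin [p] of the chosen frame cancels in differences, so inner products with sides at [A]
   can be read in coordinates. *)
have sq X : X \in [:: A; B; C; D] -> X - A = dot (X - A) e1 *: e1 + dot (X - A) e2 *: e2.
  move=> XF; rewrite {1}(inF X XF) {1}(inF A) ?inE ?eqxx //.
  by rewrite -!(zE X A); apply/rowP => k; rewrite !mxE; ring.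
have dotF X Y : X \in [:: A; B; C; D] ->
    dot (X - A) (Y - A) = dot (X - A) e1 * dot (Y - A) e1 + dot (X - A) e2 * dot (Y - A) e2.
  move=> XF.
  have -> : dot (X - A) (Y - A)
      = dot (dot (X - A) e1 *: e1 + dot (X - A) e2 *: e2) (Y - A) by rewrite -sq.
  by rewrite (dotDl (_ *: e1)) (dotZl _ e1) (dotZl _ e2) !(dotC _ (Y - A)).
rewrite /= /csub /cinv /cmul /= !zE.
have CB : C - B = (C - A) - (B - A) by rewrite opprB addrA subrK.
have n0 : sqn (C - B) != 0.
  apply: contra_eq_neq E1 => ->; rewrite mulr0 eq_sym !mulf_neq0 // ?subr_eq0 //.
  by rewrite dot_eq0.
have d0 : sqn (D - A) != 0 by rewrite dot_eq0.
have BC : B - C = (B - A) - (C - A) by rewrite opprB addrA subrK.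
have CD : C - D = (C - A) - (D - A) by rewrite opprB addrA subrK.
have AB : A - B = - (B - A) by rewrite opprB.
have Bin : B \in [:: A; B; C; D] by rewrite !inE eqxx orbT.
have Din : D \in [:: A; B; C; D] by rewrite !inE eqxx !orbT.
move: E n0 d0 (dotF B B Bin) (dotF B D Bin) (dotF D D Din).
rewrite BC CD AB CB eCA; move: (B - A) (D - A) => b d.
rewrite !dotE => + + + eb eq ed; rewrite (dotC d b) eb eq ed.
move: (dot b e1) (dot b e2) (dot d e1) (dot d e2) => b1 b2 d1 d2 E n0 d0.
set n := (b1 - (x * b1 + y * d1)) ^+ 2 + (b2 - (x * b2 + y * d2)) ^+ 2.
have {}n0 : n != 0 by apply: contraNneq n0 => n0; apply/eqP; rewrite -n0 /n; ring.
(* Let E be the left side of the circle equation. Without assuming E = 0,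
   [y d^* (C - D) = E - x b^* (C - B)]; multiplying by [b (C - B)^* / |C - B|^2] and taking real
   parts gives this coefficient of E. *)
apply: (eq_of_lin1 (k := (b1 * (x * b1 + y * d1 - b1) + b2 * (x * b2 + y * d2 - b2)) / n) E).
by rewrite /n in n0 *; field; rewrite n0 -!expr2 in d0 *.
Qed.

Lemma dual_edges A B C D A' B' C' D' :
  A != B -> A != D -> dual_quads A B C D A' B' C' D' ->
  (exists k, B' - A' = k *: (B - A)) /\ (exists k, D' - A' = k *: (D - A)).
Proof.
move=> AB AD [[pAB _ _ pDA] _]; split.
  by apply: parallelP pAB; rewrite subr_eq0 eq_sym.
have [|k e] := parallelP _ pDA; first by rewrite subr_eq0.
by exists k; apply: oppr_inj; rewrite -scalerN !opprB.
Qed.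

(* The dual diagonal [D' - B'] is parallel to [C - A], which fixes the ratio of
   the edge factors; by [cross_ratioE] the rescaled ratio is the cross-ratio. *)
Lemma dual_cross_ratio A B C D A' B' C' D' k l :
  concircular A B C D -> planar_quad A B C D ->
  dual_quads A B C D A' B' C' D' ->
  B' - A' = k *: (B - A) -> D' - A' = l *: (D - A) ->
  cross_ratio A B C D * (l * sqn (D - A)) = k * sqn (B - A).
Proof.
move=> circ /planar_quad_coord[x [y qc]] [_ [_ pAC]] eB eD.
have q := cross_ratioE circ qc; case: qc => eCA fr xn0 yn0 _.
have CA0 : C - A != 0.
  by rewrite eCA; apply: contraNneq xn0 => /fr[->].
have [r er] := parallelP CA0 pAC.
have [] := fr (- k - r * x) (l - r * y).
  have := er; rewrite eCA.
  have -> : D' - B' = (D' - A') - (B' - A') by rewrite opprB addrA subrK.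
  rewrite eB eD => e1; apply: (eq_of_sub e1).
  by apply/rowP => i; rewrite !mxE; ring.
move=> ek el; apply: (mulfI yn0).
have {}ek : k = - (r * x) by apply: (eq_of_lin1 (k := -1) ek); ring.
have {}el : l = r * y by apply: (eq_of_sub el); ring.
by rewrite ek el; apply: (eq_of_lin1 (k := r * y) q); ring.
Qed.

(** * Dual of a circular quadrilateral from edge labels *)

Section Dualization.
Variables (A B C D : pt) (x y li lj : R).
Hypotheses (circ : concircular A B C D) (circ' : concircular A D C B).
Hypothesis qc : quad_coord A B C D x y.
Hypotheses (lj0 : lj != 0) (liE : li = cross_ratio A B C D * lj).

(** All four edge factors are multiples of one [k], so closing up and duality become rational
    identities in [x] and [y]. The lengths of [CB] and [CD] come from [concircular_sqnBC] in both
    orientations. *)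
Lemma label_factors : exists2 k, k != 0 &
  [/\ li / sqn (B - A) = - k * x, lj / sqn (D - A) = k * y,
      lj / sqn (C - B) = k * x / (x + y - 1)
    & li / sqn (C - D) = - k * y / (x + y - 1)].
Proof.
have q := cross_ratioE circ qc; have s1 := concircular_sqnBC circ qc.
have := concircular_sqnBC circ' (quad_coord_swap qc).
case: qc => _ fr xn0 yn0 /andP[_]; rewrite -subr_eq0 => w0 s2.
have [bn0 dn0] := free2_neq0 fr.
move: q s1 s2; rewrite liE; move: (cross_ratio _ _ _ _) => q.
move: bn0 dn0; rewrite -!dot_eq0; move: (sqn (B - A)) (sqn (D - A)) => b d bn0 dn0.
move=> qE s1 s2; rewrite (addrC y) in s2.
have -> : q = - (x * b) / (y * d).
  by apply: (canRL (mulfK _)); rewrite ?mulf_neq0.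
have -> : sqn (C - B) = y * (x + y - 1) * d / x.
  by apply: (canRL (mulfK _)); rewrite // mulrC.
have -> : sqn (C - D) = x * (x + y - 1) * b / y.
  by apply: (canRL (mulfK _)); rewrite // mulrC.
exists (lj / (y * d)); first by rewrite mulf_neq0 // invr_eq0 mulf_neq0.
by split; field; rewrite ?xn0 ?yn0 ?bn0 ?dn0 ?w0.
Qed.

(** The rescaled edges give the same sum along both paths from [A] to [C]: this is closedness of the
    1-form on one face. *)
Lemma label_closed :
  (li / sqn (B - A)) *: (B - A) + (lj / sqn (C - B)) *: (C - B)
  = (lj / sqn (D - A)) *: (D - A) + (li / sqn (C - D)) *: (C - D).
Proof.
have [k _ [-> -> -> ->]] := label_factors.
case: qc => eCA _ _ _ /andP[_]; rewrite -subr_eq0 => w0.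
have -> : C - B = (C - A) - (B - A) by rewrite opprB addrA subrK.
have -> : C - D = (C - A) - (D - A) by rewrite opprB addrA subrK.
rewrite eCA; move: (B - A) (D - A) => b d.
by apply/rowP => i; rewrite !mxE; field.
Qed.

Lemma label_dual A' B' C' D' :
  B' - A' = (li / sqn (B - A)) *: (B - A) ->
  D' - A' = (lj / sqn (D - A)) *: (D - A) ->
  C' - B' = (lj / sqn (C - B)) *: (C - B) ->
  C' - D' = (li / sqn (C - D)) *: (C - D) ->
  planar_quad A' B' C' D' /\ dual_quads A B C D A' B' C' D'.
Proof.
move=> eB eD eCB eCD; have eCA' : C' - A' = (C' - B') + (B' - A') by rewrite addrA subrK.
have eDB' : D' - B' = (D' - A') - (B' - A') by rewrite opprB addrA subrK.
have DB : D - B = (D - A) - (B - A) by rewrite opprB addrA subrK.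
have CB : C - B = (C - A) - (B - A) by rewrite opprB addrA subrK.
have parN v w (k : R) : v = k *: w -> parallel (- v) (- w).
  by move=> ->; rewrite -scalerN; exact: parallel_scale.
have par v w (k : R) : v = k *: w -> parallel v w.
  by move=> ->; exact: parallel_scale.
have pDC : parallel (D' - C') (D - C) by rewrite -opprB -(opprB C); apply: parN eCD.
have pDA : parallel (A' - D') (A - D) by rewrite -opprB -(opprB D); apply: parN eD.
have pAB := par _ _ _ eB; have pBC := par _ _ _ eCB.
have [k kn0 [kb kd kc _]] := label_factors.
rewrite kb in eB; rewrite kd in eD; rewrite kc CB in eCB.
case: (qc) => eCA fr xn0 yn0 /andP[xyn0]; rewrite -subr_eq0 => w0.
split; last first.
  split; first by split.
  rewrite eCA' eDB' DB eCB eD eB eCA; split.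
    apply: (par _ _ (k * x * y / (x + y - 1))).
    by move: (B - A) (D - A) => b d; apply/rowP => i; rewrite !mxE; field.
  by apply: (par _ _ k); move: (B - A) (D - A) => b d; apply/rowP => i; rewrite !mxE; ring.
(* With [b = B - A] and [d = D - A], the dual diagonal [C' - A'] is [k x y / (x + y - 1)] times
   [d - b]; comparing with the dual sides [- k x b] and [k y d] gives these coordinates. *)
apply: (@coord_planar_quad _ _ _ _ _ _ (y / (x + y - 1)) (x / (x + y - 1))); split.
- have -> : C' - A' = (C' - B') + (B' - A') by rewrite addrA subrK.
  rewrite eCB eB eD eCA; move: (B - A) (D - A) => b d.
  by apply/rowP => i; rewrite !mxE; field.
- move=> s t; rewrite eB eD !scalerA => /fr[/eqP + /eqP].
  rewrite !mulf_eq0 !oppr_eq0 (negPf kn0) (negPf xn0) (negPf yn0) !orbF.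
  by move=> /eqP-> /eqP->.
- by rewrite mulf_neq0 ?invr_eq0.
- by rewrite mulf_neq0 ?invr_eq0.
- rewrite -mulrDl (addrC y) mulf_neq0 ?invr_eq0 //=.
  apply/eqP => /(canRL (mulfVK w0)); rewrite mul1r => /eqP.
  by rewrite eq_sym -subr_eq0 addrAC subrr add0r oppr_eq0 oner_eq0.
Qed.

End Dualization.

(* Moebius' theorem on pairs of mutually inscribed tetrahedra: in the affine
   frame [f1, f2, f3] at [f0], if [f0, f12, f23, f31] are coplanar
   (the product hypothesis), then so are [f1, f2, f3, f123]. *)
Lemma cube_coplanar (x12 y12 x23 y23 x31 y31 X1 Y1 X2 Y2 X3 Y3 p r s : R) :
  y12 != 0 -> y23 != 0 -> x12 != 0 -> x23 != 0 -> x31 != 0 -> y31 != 0 ->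
  x12 * x23 * x31 = - (y12 * y23 * y31) ->
  X1 + Y1 != 1 ->
  [/\ p = 1 + X1 * (x12 - 1) + Y1 * (y31 - 1), r = X1 * y12 & s = Y1 * x31] ->
  [/\ p = Y2 * x12, r = 1 + X2 * (x23 - 1) + Y2 * (y12 - 1) & s = X2 * y23] ->
  [/\ p = X3 * y31, r = Y3 * x23 & s = 1 + X3 * (x31 - 1) + Y3 * (y23 - 1)] ->
  p + r + s = 1.
Proof.
move=> y12n y23n x12n x23n x31n y31n prod XY1 [p1 r1 s1] [p2 r2 s2] [p3 r3 s3].
(* [1], [rho2], [rho3] are the coefficients of a linear form vanishing on [f12 - f0], [f23 - f0]
   and, by the product hypothesis, [f31 - f0]. Its value at [f123 - f0] is [1 - X1 - Y1], which is
   nonzero. *)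
pose rho2 := - x12 / y12; pose rho3 := x12 * x23 / (y12 * y23).
have y31E : y31 = - (rho3 * x31).
  rewrite /rho3; apply: (mulfI (mulf_neq0 y12n y23n)).
  apply: (eq_of_lin1 (k := 1) prod).
  by field; rewrite y12n y23n.
have sigma : p + rho2 * r + rho3 * s = 1 - X1 - Y1.
  by rewrite p1 r1 s1 y31E /rho2; field.
have sn0 : p + rho2 * r + rho3 * s != 0.
  rewrite sigma; apply: contraNneq XY1 => e0; rewrite -subr_eq0.
  by apply/eqP; apply: (eq_of_lin1 (k := -1) e0); ring.
apply/eqP; rewrite -subr_eq0; apply/eqP; apply: (mulfI sn0); rewrite mulr0.
have div (a b c : R) : b != 0 -> c = a * b -> a = c / b by move=> b0 ->; rewrite mulfK.
move: p1 r2 s3; rewrite (div _ _ _ y12n r1) (div _ _ _ x31n s1) (div _ _ _ x12n p2).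
rewrite (div _ _ _ y23n s2) (div _ _ _ y31n p3) (div _ _ _ x23n r3) => p1 r2 s3.
(* With these weights the mixed terms combine and the sum factors as [(p + rho2 * r + rho3 * s) * (p
   + r + s - 1)]. *)
apply: (eq_of_lin3 (k1 := p) (k2 := rho2 * r) (k3 := rho3 * s) p1 r2 s3).
by rewrite y31E /rho2 /rho3; field; rewrite x12n y12n x23n y23n x31n.
Qed.

(** * Opposite faces of an elementary cube *)

Section Cube.
Variables f0 f1 f2 f3 f12 f23 f31 f123 : pt.
Hypothesis gp : free3 (f1 - f0) (f2 - f0) (f3 - f0).
Hypotheses (P12 : planar_quad f0 f1 f12 f2) (P23 : planar_quad f0 f2 f23 f3)
  (P31 : planar_quad f0 f3 f31 f1).
Hypotheses (Q1 : planar_quad f1 f12 f123 f31) (Q2 : planar_quad f2 f23 f123 f12)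
  (Q3 : planar_quad f3 f31 f123 f23).
Hypotheses (C12 : concircular f0 f1 f12 f2) (C23 : concircular f0 f2 f23 f3)
  (C32 : concircular f0 f3 f23 f2) (C31 : concircular f0 f3 f31 f1)
  (D3 : concircular f3 f31 f123 f23).

Lemma cube_cross_ratio :
  cross_ratio f0 f1 f12 f2 * cross_ratio f0 f2 f23 f3 * cross_ratio f0 f3 f31 f1 = 1 ->
  cross_ratio f3 f31 f123 f23 = cross_ratio f0 f1 f12 f2.
Proof.
have [x12 [y12 q12]] := planar_quad_coord P12; have := cross_ratioE C12 q12.
have [x23 [y23 q23]] := planar_quad_coord P23; have := cross_ratioE C23 q23.
have [x31 [y31 q31]] := planar_quad_coord P31; have := cross_ratioE C31 q31.
have [X1 [Y1 g1]] := planar_quad_coord Q1.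
have [X2 [Y2 g2]] := planar_quad_coord Q2.
have [X3 [Y3 g3]] := planar_quad_coord Q3; have := cross_ratioE D3 g3.
have := concircular_sqnBC C31 q31; have := concircular_sqnBC C32 (quad_coord_swap q23).
move: (cross_ratio f3 _ _ _) (cross_ratio f0 f1 _ _) (cross_ratio f0 f2 _ _).
move: (cross_ratio f0 f3 _ _) => c31 c3 c12 c23.
move=> n23 n31 e3 e31 e23 e12 prod.
case: q12 q23 q31 => e12' fr12 x12n y12n /andP[_ w12].
case=> e23' fr23 x23n y23n /andP[_ w23]; case=> e31' fr31 x31n y31n /andP[_ w31].
case: g1 => d1 _ X1n Y1n /andP[_ W1]; case: g2 => d2 _ X2n Y2n _.
case: g3 => d3 _ X3n Y3n _.
have [an0 bn0] := free2_neq0 fr12; have [_ cn0] := free2_neq0 fr23.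
move: an0 bn0 cn0; rewrite -!dot_eq0 => an0 bn0 cn0.
pose a := f1 - f0; pose b := f2 - f0; pose c := f3 - f0.
have f12E : f12 = f0 + x12 *: a + y12 *: b by rewrite -addrA -e12' addrC subrK.
have f23E : f23 = f0 + x23 *: b + y23 *: c by rewrite -addrA -e23' addrC subrK.
have f31E : f31 = f0 + x31 *: c + y31 *: a by rewrite -addrA -e31' addrC subrK.
have f1E : f1 = f0 + a by rewrite addrC subrK.
have f2E : f2 = f0 + b by rewrite addrC subrK.
have f3E : f3 = f0 + c by rewrite addrC subrK.
have d1' : f123 = f1 + X1 *: (f12 - f1) + Y1 *: (f31 - f1).
  by rewrite -addrA -d1 addrC subrK.
have d2' : f123 = f2 + X2 *: (f23 - f2) + Y2 *: (f12 - f2).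
  by rewrite -addrA -d2 addrC subrK.
have d3' : f123 = f3 + X3 *: (f31 - f3) + Y3 *: (f23 - f3).
  by rewrite -addrA -d3 addrC subrK.
(* Coordinates of [f123] in the frame [a], [b], [c] at [f0], computed in the face at [f1]; general
   position makes the computations in the faces at [f2] and [f3] agree with them. *)
pose p := 1 + X1 * (x12 - 1) + Y1 * (y31 - 1); pose r := X1 * y12; pose s := Y1 * x31.
have dE : f123 = f0 + p *: a + r *: b + s *: c.
  rewrite d1' f12E f31E {1 2 3}f1E /p /r /s; move: (a) (b) (c) => a' b' c'.
  by apply/rowP => i; rewrite !mxE; ring.
have coef2 : [/\ p = Y2 * x12, r = 1 + X2 * (x23 - 1) + Y2 * (y12 - 1) & s = X2 * y23].
  have [] := gp (s := p - Y2 * x12) (t := r - (1 + X2 * (x23 - 1) + Y2 * (y12 - 1)))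
                (r := s - X2 * y23).
    have := etrans (esym dE) d2'; rewrite -/a -/b -/c f23E f12E {1 2 3}f2E => e0.
    apply: (eq_of_sub e0); move: (a) (b) (c) (p) (r) (s) => a' b' c' p' r' s'.
    by apply/rowP => i; rewrite !mxE; ring.
  by do 3![move/eqP; rewrite subr_eq0 => /eqP ?].
have coef3 : [/\ p = X3 * y31, r = Y3 * x23 & s = 1 + X3 * (x31 - 1) + Y3 * (y23 - 1)].
  have [] := gp (s := p - X3 * y31) (t := r - Y3 * x23)
                (r := s - (1 + X3 * (x31 - 1) + Y3 * (y23 - 1))).
    have := etrans (esym dE) d3'; rewrite -/a -/b -/c f23E f31E {1 2 3}f3E => e0.
    apply: (eq_of_sub e0); move: (a) (b) (c) (p) (r) (s) => a' b' c' p' r' s'.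
    by apply/rowP => i; rewrite !mxE; ring.
  by do 3![move/eqP; rewrite subr_eq0 => /eqP ?].
move: n23 n31 e3 e31 e23 e12 an0 bn0 cn0.
move: (sqn (f1 - f0)) (sqn (f2 - f0)) (sqn (f3 - f0)) (sqn (f23 - f3)) (sqn (f31 - f3)).
move=> aa bb cc n23 n31 n23E n31E e3 e31 e23 e12 an0 bn0 cn0.
(* In the product of the three cross-ratios the squared edge lengths at [f0] cancel. *)
have prod_xy : x12 * x23 * x31 = - (y12 * y23 * y31).
  have nz : aa * bb * cc != 0 by rewrite !mulf_neq0.
  apply: (mulIf nz).
  transitivity (- (- (x12 * aa) * - (x23 * bb) * - (x31 * cc))); first by ring.
  rewrite -e12 -e23 -e31.
  by apply: (eq_of_lin1 (k := - (y12 * bb * y23 * cc * y31 * aa)) prod); ring.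
have prs1 : p + r + s = 1.
  exact: (cube_coplanar y12n y23n x12n x23n x31n y31n prod_xy W1 _ coef2 coef3).
(* The affine form (sum of coordinates minus 1) vanishes at [f1], [f2], [f3] and takes the values
   [w] at [f23] and [v] at [f31]; its vanishing at [f123] is [omega]. *)
pose w := x23 + y23 - 1; pose v := x31 + y31 - 1.
have wn0 : w != 0 by rewrite subr_eq0.
have omega : X3 * v = - (Y3 * w).
  case: coef3 => p3 r3 s3; move: prs1; rewrite p3 r3 s3 => omega.
  by apply: (eq_of_sub omega); rewrite /v /w; ring.
have nz : Y3 * x23 * w * bb * x31 * y12 != 0 by rewrite !mulf_neq0.
apply: (mulfI nz).
transitivity (y12 * y23 * y31 * aa * (Y3 * w)); last first.
  apply: (eq_of_lin2 (k1 := aa * Y3 * w) (k2 := - (Y3 * x23 * w * x31)) prod_xy e12).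
  by rewrite /w; ring.
apply: (eq_of_lin3 (k1 := - (x31 * y12 * c3 * Y3)) (k2 := x31 * y12 * y23)
  (k3 := - (y12 * y23 * X3)) n23E e3 n31E).
have -> : Y3 * w = - (X3 * v) by rewrite omega opprK.
by rewrite /v /w; ring.
Qed.
End Cube.

End Circles.

(** * Functions and sums over the integers *)

Lemma int_const (T : Type) (g : int -> T) :
  (forall s, g (s + 1) = g s) -> forall s, g s = g 0.
Proof.
move=> gS; elim/int_rect => [//|n IH|n IH]; first by rewrite -addn1 PoszD gS.
by rewrite -gS -addn1 PoszD opprD subrK.
Qed.

(** The primitive of [g] normalised at 0. Since [Negz n] is [-(n + 1)], the second branch subtracts
    the values at [-1] down to [-(n + 1)]. *)
Definition int_sum (V : zmodType) (g : int -> V) (s : int) : V :=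
  match s with
  | Posz n => \sum_(i < n) g (Posz i)
  | Negz n => - \sum_(i < n.+1) g (Negz i)
  end.

Lemma int_sum0 (V : zmodType) (g : int -> V) : int_sum g 0 = 0.
Proof. exact: big_ord0. Qed.

Lemma int_sumS (V : zmodType) (g : int -> V) s :
  int_sum g (s + 1) = int_sum g s + g s.
Proof.
case: s => [n|[|n]].
- by rewrite -PoszD addn1 /= big_ord_recr.
- by rewrite /= big_ord0 big_ord1 addNr.
have -> : Negz n.+1 + 1 = Negz n by rewrite !NegzE -addn1 PoszD opprD subrK.
by rewrite /= [in RHS]big_ord_recr /= opprD -addrA addNr addr0.
Qed.

(** * Closed 1-forms and edge labels on the lattice *)

Section Lattice.
Variable m : nat.
Implicit Types (u v : 'rV[int]_m) (i j k : 'I_m).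

Lemma shC u i j : sh (sh u i) j = sh (sh u j) i.
Proof. exact: addrAC. Qed.

Lemma sh_same u i : sh u i 0 i = u 0 i + 1.
Proof. by rewrite !mxE !eqxx. Qed.

Lemma sh_other u i j : i != j -> sh u j 0 i = u 0 i.
Proof. by move=> ij; rewrite !mxE (negPf ij) andbF addr0. Qed.

Lemma scale_eE (s : int) i k : (s *: e i) 0 k = if k == i then s else 0.
Proof. by rewrite !mxE eqxx /=; case: eqP; rewrite ?mulr1 ?mulr0. Qed.

Lemma shift_const (T : Type) (g : 'rV[int]_m -> T) k :
  (forall u, g (sh u k) = g u) -> forall u s, g (u + s *: e k) = g u.
Proof.
move=> gS u s; have := @int_const _ (fun s => g (u + s *: e k)) _ s.
rewrite scale0r addr0; apply=> {}s.
by rewrite scalerDl scale1r addrA -/(sh _ k) gS.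
Qed.

Lemma const_off (T : Type) (g : 'rV[int]_m -> T) (P : pred 'I_m) :
  (forall u k, P k -> g (sh u k) = g u) ->
  forall u v, (forall k, ~~ P k -> u 0 k = v 0 k) -> g u = g v.
Proof.
move=> gS u v uv.
have -> : v = u + \sum_k (v 0 k - u 0 k) *: e k.
  rewrite -[LHS](subrK u) addrC; congr (_ + _); rewrite [LHS]row_sum_delta.
  by apply: eq_bigr => k _; rewrite !mxE.
have uv0 k : ~~ P k -> v 0 k - u 0 k = 0 by move=> /uv->; rewrite subrr.
elim: (index_enum _) => [|k s IH]; first by rewrite big_nil addr0.
rewrite big_cons addrCA addrC; have [Pk|/uv0->] := boolP (P k).
  by rewrite shift_const // => ?; rewrite gS.
by rewrite scale0r addr0.
Qed.

(** Discrete Poincare lemma, by induction on the number of directions: a primitive on the hyperplane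
    where the new coordinate [k] is 0 is extended by summing [w k] along the k-th axis. *)
Lemma closed_form_exact (V : zmodType) (w : 'I_m -> 'rV[int]_m -> V) :
  (forall u i j, i != j -> w i u + w j (sh u i) = w j u + w i (sh u j)) ->
  exists F, forall u i, F (sh u i) = F u + w i u.
Proof.
move=> closed.
suff: forall n, (n <= m)%N ->
    exists F, forall u i, (i < n)%N -> F (sh u i) = F u + w i u.
  by case/(_ m (leqnn m)) => F FE; exists F => u i; apply: FE.
elim=> [_|n IH nm]; first by exists (fun=> 0).
have [F FE] := IH (ltnW nm); pose k : 'I_m := Ordinal nm.
pose z u := u - u 0 k *: e k.
have zk u : z u + u 0 k *: e k = u by rewrite subrK.
pose g u s := w k (z u + s *: e k).
exists (fun u => F (z u) + int_sum (g u) (u 0 k)) => u i.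
rewrite ltnS leq_eqVlt => /orP[/eqP ik|lt_in].
  have -> : i = k by apply: val_inj.
  have zS : z (sh u k) = z u.
    by rewrite /z sh_same scalerDl scale1r /sh opprD addrACA subrr addr0.
  by rewrite /g zS sh_same int_sumS -/(g u) addrA zk.
have ik : i != k by apply: contraTneq lt_in => ->; rewrite ltnn.
have zS : z (sh u i) = sh (z u) i.
  by rewrite /z sh_other 1?eq_sym // /sh addrAC.
rewrite zS FE // sh_other 1?eq_sym //.
suff H s : w i (z u) + int_sum (g (sh u i)) s = int_sum (g u) s + w i (z u + s *: e k).
  by rewrite -addrA H addrA zk.
apply/eqP; rewrite -subr_eq0; apply/eqP; move: s.
(* [T s] is the circulation around a strip of height [s]; closedness adds nothing at each unit step,
   and the strip of height 0 is trivial. *)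
pose T s := w i (z u) + int_sum (g (sh u i)) s - (int_sum (g u) s + w i (z u + s *: e k)).
suff TS s : T (s + 1) = T s.
  by move=> s; rewrite -/(T s) (int_const TS) /T !int_sum0 scale0r !addr0 add0r subrr.
have c := closed (z u + s *: e k) i k ik.
have gE : g (sh u i) s = w k (sh (z u + s *: e k) i) by rewrite /g zS /sh addrAC.
have sE : z u + (s + 1) *: e k = sh (z u + s *: e k) k.
  by rewrite scalerDl scale1r addrA.
rewrite /T !int_sumS sE gE -[int_sum (g u) s + g u s + _]addrA -c.
by rewrite [w i (z u) + (_ + _)]addrA [int_sum (g u) s + (_ + _)]addrA opprD addrACA subrr addr0.
Qed.

(* The values of [Q i j] depend only on the i-th and j-th coordinates, so in
   [Q i j = Q i k * Q k j] the k-th one may be set to 0, which separates them. *)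
Lemma edge_labels (R : fieldType) (Q : 'I_m -> 'I_m -> 'rV[int]_m -> R) :
  (3 <= m)%N ->
  (forall i j u, i != j -> Q i j u * Q j i u = 1) ->
  (forall i j k u, i != j -> j != k -> k != i -> Q i j u * Q j k u * Q k i u = 1) ->
  (forall i j k u, i != j -> j != k -> k != i -> Q i j (sh u k) = Q i j u) ->
  exists l : 'I_m -> int -> R, (forall i s, l i s != 0) /\
    forall i j u, i != j -> l i (u 0 i) = Q i j u * l j (u 0 j).
Proof.
move=> m3 inv triple shift.
have Qn0 i j u : i != j -> Q i j u != 0.
  by move=> ij; apply: contra_eq_neq (inv i j u ij) => ->; rewrite mul0r eq_sym oner_eq0.
have comp i j k u : i != j -> j != k -> k != i -> Q i j u = Q i k u * Q k j u.
  move=> ij jk ki; have e1 := triple i j k u ij jk ki.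
  have e2 := inv k i u ki; have e3 := inv j k u jk.
  apply: (mulIf (Qn0 j k u jk)); apply: (mulIf (Qn0 k i u ki)); rewrite e1.
  transitivity ((Q k i u * Q i k u) * (Q j k u * Q k j u)); last by ring.
  by rewrite e2 e3 mulr1.
have agree i j u v : i != j -> u 0 i = v 0 i -> u 0 j = v 0 j -> Q i j u = Q i j v.
  move=> ij ui uj; apply: (@const_off _ _ [pred k | (k != i) && (k != j)]).
    by move=> {ui uj}u k /andP[ki kj]; apply: shift; rewrite // eq_sym.
  by move=> k; rewrite negb_and !negbK => /orP[]/eqP->.
have split i j k u : i != j -> j != k -> k != i ->
    Q i j u = Q i k (u 0 i *: e i) * Q k j (u 0 j *: e j).
  move=> ij jk ki.
  rewrite (@agree i j u (u - u 0 k *: e k)) //; first last.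
  - by rewrite mxE [X in _ + X]mxE scale_eE (negPf jk) oppr0 addr0.
  - by rewrite mxE [X in _ + X]mxE scale_eE eq_sym (negPf ki) oppr0 addr0.
  have ik : (i == k) = false by rewrite eq_sym (negPf ki).
  have kj : (k == j) = false by rewrite eq_sym (negPf jk).
  rewrite (comp i j k) //; congr (_ * _); apply: agree;
    rewrite // ?ik ?kj // scale_eE ?eqxx mxE [X in _ + X]mxE scale_eE;
    by rewrite ?eqxx ?ik ?kj ?(negPf jk) ?(negPf ki) ?subr0 ?subrr.
pose o := Ordinal (leq_trans (isT : 0 < 3)%N m3).
pose p := Ordinal (leq_trans (isT : 1 < 3)%N m3).
pose r := Ordinal (leq_trans (isT : 2 < 3)%N m3).
(* Labels are normalised against the base index [o]. As [Q o o] is not controlled, the label of [o]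
   itself passes through [p]; the third index [r] serves to compare [o] with [p]. *)
pose l i s := if i == o then Q o p (s *: e o) * Q p o 0 else Q i o (s *: e i).
have split1 i j k s : i != j -> j != k -> k != i ->
    Q i j (s *: e i) = Q i k (s *: e i) * Q k j 0.
  move=> ij jk ki; rewrite (split i j k) // !scale_eE eqxx eq_sym (negPf ij).
  by rewrite scale0r.
have split2 i j k s : i != j -> j != k -> k != i ->
    Q i j (s *: e j) = Q i k 0 * Q k j (s *: e j).
  move=> ij jk ki; rewrite (split i j k) // !scale_eE eqxx (negPf ij).
  by rewrite scale0r.
have lo j u : j != o -> l o (u 0 o) = Q o j u * l j (u 0 j).
  move=> jo; rewrite /l eqxx (negPf jo); have [jp|jp] := eqVneq j p.
    rewrite {}jp (split o p r u) // (split1 o r p) // (split2 r p o) //.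
    rewrite (comp p o r) //; transitivity
      (Q o p (u 0 o *: e o) * (Q p r 0 * Q r o 0) * (Q o p (u 0 p *: e p) * Q p o (u 0 p *: e p))).
      by rewrite inv // mulr1.
    by ring.
  have oj : o != j by rewrite eq_sym.
  have pj : p != j by rewrite eq_sym.
  by rewrite (split o j p u) // (split2 p j o) // -!mulrA inv ?mulr1.
have ln0 i s : l i s != 0.
  by rewrite /l; have [_|io] := eqVneq i o; rewrite ?mulf_neq0 ?Qn0.
exists l; split=> // i j u ij.
have [io|io] := eqVneq i o; first by rewrite io (lo j) // -io eq_sym.
have [jo|jo] := eqVneq j o.
  by rewrite jo (lo i) // mulrA inv // mul1r.
rewrite /l (negPf io) (negPf jo) (split i j o u) //; last by rewrite eq_sym.
by rewrite -mulrA inv ?mulr1 // eq_sym.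
Qed.

End Lattice.

(** * The two implications for circular nets *)

Section Nets.
Variables (R : rcfType) (m N : nat) (f : 'rV[int]_m -> 'rV[R]_N).
Hypothesis circ : circular_net f.
Implicit Types (u : 'rV[int]_m) (i j k : 'I_m).

Let Q i j u := cross_ratio (f u) (f (sh u i)) (f (sh (sh u i) j)) (f (sh u j)).

Lemma isothermic_cross_ratio :
  discrete_isothermic f ->
  forall u i j k, i != j -> j != k -> k != i -> Q i j u * Q j k u * Q k i u = 1.
Proof.
case: circ => qn cn [_ [_ [fs [qs dual]]]] u i j k ij jk ki.
have dist v a b : a != b -> (f v != f (sh v a)) * (f v != f (sh v b)).
  move=> ab; have [x [y [_ fr _ _ _]]] := planar_quad_coord (qn v a b ab).
  by have := free2_neq0 fr; rewrite !subr_eq0 !(eq_sym _ (f v)).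
have [] := dual_edges (dist u i j ij).1 (dist u i j ij).2 (dual u i j ij).
move=> [ki' eki] [kj' ekj].
have [_ [kk' ekk]] := dual_edges (dist u j k jk).1 (dist u j k jk).2 (dual u j k jk).
(* Two faces at [u] sharing an edge also share its factor, so the three relations chain up. *)
have q1 := dual_cross_ratio (cn u i j ij) (qn u i j ij) (dual u i j ij) eki ekj.
have q2 := dual_cross_ratio (cn u j k jk) (qn u j k jk) (dual u j k jk) ekj ekk.
have q3 := dual_cross_ratio (cn u k i ki) (qn u k i ki) (dual u k i ki) ekk eki.
(* A zero factor would collapse an edge of [fs], against nondegeneracy of the dual Q-net. *)
have nz : ki' * dot (f (sh u i) - f u) (f (sh u i) - f u) != 0.
  rewrite mulf_neq0 //; last by rewrite dot_eq0 subr_eq0 eq_sym (dist u i j ij).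
  apply/eqP => k0; have [x [y [_ fr _ _ _]]] := planar_quad_coord (qs u i j ij).
  by have [] := free2_neq0 fr; rewrite eki k0 scale0r eqxx.
by apply: (mulIf nz); rewrite /Q mul1r -!mulrA q3 q2 q1.
Qed.

(** Reversing the quadrilateral swaps [x] with [y] and the two sides at [f u] in [cross_ratioE]. *)
Lemma cross_ratio_inv i j u : i != j -> Q i j u * Q j i u = 1.
Proof.
case: circ => qn cn ij; have ji : j != i by rewrite eq_sym.
have [x [y qc]] := planar_quad_coord (qn u i j ij).
have q1 := cross_ratioE (cn u i j ij) qc.
have := cn u j i ji; rewrite shC => cn'.
have := cross_ratioE cn' (quad_coord_swap qc); rewrite -shC -/(Q j i u) => q2.
rewrite -/(Q i j u) in q1; case: qc => _ fr xn0 yn0 _; have [bn0 dn0] := free2_neq0 fr.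
move: q1 q2 bn0 dn0; rewrite -!dot_eq0.
move: (dot (f (sh u i) - _) _) (dot (f (sh u j) - _) _) => b d q1 q2 bn0 dn0.
have nz : y * d * (x * b) != 0 by rewrite !mulf_neq0.
by apply: (mulIf nz); rewrite mulrACA q1 q2; ring.
Qed.

Hypothesis gp : general_position f.
Hypothesis triple :
  forall u i j k, i != j -> j != k -> k != i -> Q i j u * Q j k u * Q k i u = 1.

Lemma cross_ratio_shift i j k u :
  i != j -> j != k -> k != i -> Q i j (sh u k) = Q i j u.
Proof.
case: circ => qn cn ij jk ki.
have [ji kj ik] : [/\ j != i, k != j & i != k] by split; rewrite eq_sym.
have prod := triple u ij jk ki; rewrite /Q.
rewrite (shC u k j) (shC (sh u k) i j) (shC u k j).
apply: (cube_cross_ratio (f1 := f (sh u i)) (f2 := f (sh u j)) (f3 := f (sh u k))) prod.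
- exact: rank3_free3 (gp u ij jk ki).
- exact: (qn u i j ij).
- exact: (qn u j k jk).
- exact: (qn u k i ki).
- by rewrite (shC (sh u j) k i) (shC u j i) (shC u k i); apply: (qn (sh u i) j k).
- by rewrite (shC u i j); apply: (qn (sh u j) k i).
- by rewrite (shC u j k) (shC (sh u k) j i); apply: (qn (sh u k) i j).
- exact: (cn u i j ij).
- exact: (cn u j k jk).
- by rewrite (shC u j k); apply: (cn u k j).
- exact: (cn u k i ki).
- by rewrite (shC u j k) (shC (sh u k) j i); apply: (cn (sh u k) i j).
Qed.

Lemma cross_ratio_isothermic : (3 <= m)%N -> discrete_isothermic f.
Proof.
move=> m3; split => //; case: (circ) => qn cn; split => //.
have [l [ln0 lE]] := edge_labels m3 cross_ratio_inv
  (fun i j k u => @triple u i j k) cross_ratio_shift.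
pose a i u := l i (u 0 i) / dot (f (sh u i) - f u) (f (sh u i) - f u).
(* Hence opposite edges of a face carry the same label, as [label_closed] and [label_dual]
   require. *)
have lsh i j u : i != j -> l i (sh u j 0 i) = l i (u 0 i).
  by move=> ij; rewrite sh_other.
have cn' u i j : i != j ->
    concircular (f u) (f (sh u j)) (f (sh (sh u i) j)) (f (sh u i)).
  by move=> ij; rewrite shC; apply: cn; rewrite eq_sym.
have [|fs fsE] := @closed_form_exact _ _ (fun i u => a i u *: (f (sh u i) - f u)).
  move=> u i j ij; have ji : j != i by rewrite eq_sym.
  have [x [y qc]] := planar_quad_coord (qn u i j ij).
  have := label_closed (cn u i j ij) (cn' u i j ij) qc (ln0 j (u 0 j)) (lE i j u ij).
  by rewrite /a !lsh // (shC u j i).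
have fsB u i : fs (sh u i) - fs u = a i u *: (f (sh u i) - f u).
  by rewrite fsE addrAC subrr add0r.
have main u i j : i != j ->
    planar_quad (fs u) (fs (sh u i)) (fs (sh (sh u i) j)) (fs (sh u j)) /\
    dual_quads (f u) (f (sh u i)) (f (sh (sh u i) j)) (f (sh u j))
               (fs u) (fs (sh u i)) (fs (sh (sh u i) j)) (fs (sh u j)).
  move=> ij; have ji : j != i by rewrite eq_sym.
  have [x [y qc]] := planar_quad_coord (qn u i j ij).
  apply: (label_dual (cn u i j ij) (cn' u i j ij) qc (ln0 j (u 0 j)) (lE i j u ij)).
  - exact: fsB.
  - exact: fsB.
  - by rewrite fsB /a lsh.
  - by rewrite shC fsB /a lsh // shC.
by exists fs; split=> u i j ij; have [] := main u i j ij.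
Qed.

End Nets.

Unset Implicit Arguments.

Theorem mainTheorem13 (R : rcfType) (m N : nat) (f : 'rV[int]_m -> 'rV[R]_N) :
  (3 <= m)%N -> circular_net f -> general_position f ->
  (discrete_isothermic f <->
   forall (u : 'rV[int]_m) (i j k : 'I_m), i != j -> j != k -> k != i ->
     cross_ratio (f u) (f (sh u i)) (f (sh (sh u i) j)) (f (sh u j)) *
     cross_ratio (f u) (f (sh u j)) (f (sh (sh u j) k)) (f (sh u k)) *
     cross_ratio (f u) (f (sh u k)) (f (sh (sh u k) i)) (f (sh u i)) = 1).
Proof.
move=> m3 circ gp; split; first exact: isothermic_cross_ratio.
by move=> triple; apply: cross_ratio_isothermic.
Qed.
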